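(* Let $(Q,\leq,\cdot,\rightarrow,1)$ be a poset with binary operations $\cdot$ and $\rightarrow$ and a constant $1\in Q$. Let $a,b\in Q$ and let $f,g$ be surjective mappings from $Q^2$ to $Q$ satisfying $f(a,b)=g(a,b)=1$. Consider the full twist product $(Q^2,\leq)$ of $(Q,\leq)$, equipped with the binary operations $\odot$ and $\Rightarrow$ defined by \begin{align*} (x,y)\odot(z,v) & :=(x\cdot f(z,v),\,g(z,v)\rightarrow y), \\ (x,y)\Rightarrow(z,v) & :=(f(x,y)\rightarrow z,\,v\cdot g(x,y)) \end{align*} for all $(x,y),(z,v)\in Q^2$, and with the constant $(a,b)$. Then $(Q,\leq,\cdot,\rightarrow,1)$ is a left-residuated groupoid if and only if $(Q^2,\leq,\odot,\Rightarrow,(a,b))$ is a left-residuated groupoid.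
   Context: The full twist product of a poset $(Q,\leq)$ is the poset $(Q^2,\leq)$ where $(x,y)\leq(z,v)$ if and only if $x\leq z$ and $v\leq y$. A poset with two binary operations and a constant, $(P,\leq,\cdot,\rightarrow,e)$, is called a left-residuated groupoid if for all $x,y,z\in P$: (left-adjointness) $x\cdot y\leq z$ if and only if $x\leq y\rightarrow z$; and $x\cdot e=x$. (The constant $e$ is not assumed to be the greatest element.) *)

(* Defs.v *)
From Stdlib Require Import Relations FinFun.

(* A poset is a type with a Prop-valued relation satisfying [order]
   (reflexive, transitive, antisymmetric), so no decidability is assumed. *)

Record left_residuated_groupoid (P : Type) (le : relation P)
    (mul imp : P -> P -> P) (e : P) : Prop := {
  lrg_order : order P le;
  lrg_adjoint : forall x y z : P, le (mul x y) z <-> le x (imp y z);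
  lrg_unit : forall x : P, mul x e = x
}.

Definition twist_le (Q : Type) (le : relation Q) : relation (Q * Q) :=
  fun p q => le (fst p) (fst q) /\ le (snd q) (snd p).

Definition twist_mul (Q : Type) (mul imp : Q -> Q -> Q) (f g : Q * Q -> Q)
    (p q : Q * Q) : Q * Q :=
  (mul (fst p) (f q), imp (g q) (snd p)).

Definition twist_imp (Q : Type) (mul imp : Q -> Q -> Q) (f g : Q * Q -> Q)
    (p q : Q * Q) : Q * Q :=
  (imp (f p) (fst q), mul (snd q) (g p)).

(* Main.v *)
Require Import Defs.
From Stdlib Require Import Relations FinFun.

(** Adjointness in the twist product at [p] is a conjunction of two adjunctions in [Q], one at [f p]
    and one, reversed, at [g p]. Conversely, each element of [Q] is some [f p], and choosing second
    coordinates whose inequalities always hold isolates the adjunction at [f p]. *)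

Lemma twist_order (Q : Type) (le : relation Q) :
  order Q le -> order (Q * Q) (twist_le Q le).
Proof.
  intros [le_refl le_trans le_antisym]; split.
  - intros [x y]; split; apply le_refl.
  - intros [x y] [z v] [s t] [H1 H2] [H3 H4]; split; simpl in *.
    + now apply le_trans with z.
    + now apply le_trans with v.
  - intros [x y] [z v] [H1 H2] [H3 H4]; simpl in *.
    f_equal; now apply le_antisym.
Qed.

(** Both inequalities are adjointness at [e] applied to reflexivity. Needed because multiplying by
    [(a, b)] turns the second coordinate [y] into [imp one y]. *)
Lemma lrg_imp_unit (P : Type) (le : relation P) (mul imp : P -> P -> P) (e : P) :
  left_residuated_groupoid P le mul imp e -> forall x : P, imp e x = x.
Proof.
  intros [[le_refl _ le_antisym] adj unit] x; apply le_antisym.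
  - rewrite <- (unit (imp e x)); apply adj, le_refl.
  - apply adj; rewrite unit; apply le_refl.
Qed.

Theorem theorem3p6 (Q : Type) (le : relation Q) (mul imp : Q -> Q -> Q) (one : Q)
    (le_order : order Q le) (a b : Q) (f g : Q * Q -> Q)
    (f_surj : Surjective f) (g_surj : Surjective g)
    (f_ab : f (a, b) = one) (g_ab : g (a, b) = one) :
  left_residuated_groupoid Q le mul imp one <->
  left_residuated_groupoid (Q * Q) (twist_le Q le)
    (twist_mul Q mul imp f g) (twist_imp Q mul imp f g) (a, b).
Proof.
  split.
  - intros HQ; pose proof (lrg_imp_unit _ _ _ _ _ HQ) as imp_unit.
    destruct HQ as [_ adj unit]; split.
    + now apply twist_order.
    + intros [x y] p [s t]; unfold twist_le, twist_mul, twist_imp; simpl.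
      rewrite (adj x (f p) s), (adj t (g p) y); reflexivity.
    + intros [x y]; unfold twist_mul; simpl.
      now rewrite f_ab, g_ab, unit, imp_unit.
  - intros [_ adj unit]; pose proof (ord_refl _ _ le_order) as le_refl; split.
    + assumption.
    + intros x y z; destruct (f_surj y) as [p <-].
      (* The second coordinates [x] and [g p -> x] satisfy both second-coordinate
         inequalities of the twist adjointness, so only the first ones remain. *)
      assert (counit : le (mul (imp (g p) x) (g p)) x).
      { apply (adj (x, x) p (twist_mul Q mul imp f g (x, x) p)).
        split; apply le_refl. }
      specialize (adj (x, x) p (z, imp (g p) x)).
      unfold twist_le, twist_mul, twist_imp in adj; simpl in adj.
      split; intros H; apply adj; split; trivial.
    (* The first coordinate of the twist unit law is [mul x (f (a, b)) = x]. *)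
    + intros x; rewrite <- f_ab; exact (f_equal fst (unit (x, x))).
Qed.
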